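(* Let $V=\mathbb{N}$ or $V=\mathbb{Z}$, and let $X$ be a Fréchet sequence space over $V$ in which the sequence of canonical vectors $(e_n)_{n\in V}$ is a Schauder basis. Assume that $(\|\cdot\|_k)_{k\in\mathbb{N}}$ is an increasing sequence of seminorms inducing the topology of $X$, and that $\lambda=(\lambda_n)_{n\in V}\in\mathbb{K}^V$ is a sequence of (possibly zero) weights such that the (unilateral if $V=\mathbb{N}$, bilateral if $V=\mathbb{Z}$) weighted backward shift $$B_\lambda:(f(n))_{n\in V}\in X\longmapsto(\lambda_{n+1}\cdot f(n+1))_{n\in V}\in X$$ is a well-defined operator. Then the set of chain recurrent vectors $CR(B_\lambda\vert_{CR(B_\lambda)})$ of the restricted operator $B_\lambda\vert_{CR(B_\lambda)}:CR(B_\lambda)\to CR(B_\lambda)$ coincides with the set $CR(B_\lambda)$, and hence $B_\lambda\vert_{CR(B_\lambda)}$ is chain recurrent.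
   Context: $\mathbb{K}$ denotes $\mathbb{R}$ or $\mathbb{C}$ and $\mathbb{N}=\{1,2,\dots\}$. A Fréchet space is a locally convex, completely metrizable topological vector space. $\mathbb{K}^V$ is the space of all sequences $f=(f(n))_{n\in V}$ with the product topology; $e_n$ is the canonical unit sequence (equal to $1$ at $n$ and $0$ elsewhere). A Fréchet sequence space over $V$ is a linear subspace $X\subset\mathbb{K}^V$ endowed with a Fréchet space topology for which the canonical embedding $X\hookrightarrow\mathbb{K}^V$ is continuous. The shift $B_\lambda$ is well-defined on $X$ if it maps $X$ into itself (it is then continuous by the Closed Graph Theorem). Chain recurrence. Let $X$ be a Fréchet space with topology induced by an increasing sequence of seminorms $(\|\cdot\|_k)_{k\in\mathbb{N}}$, and put $\|f\|:=\sum_{k\in\mathbb{N}}2^{-k}\min\{1,\|f\|_k\}$, so that $d(f,g)=\|f-g\|$ is a translation-invariant metric inducing the topology (if $X$ is Banach, $\|\cdot\|$ denotes its norm). Let $T:X\to X$ be a continuous linear operator. Given $\delta>0$, a finite sequence $(f_l)_{l=0}^m$ in $X$, with $m\in\mathbb{N}$, is a $\delta$-chain for $T$ from $f_0$ to $f_m$ if $\|f_l-T(f_{l-1})\|<\delta$ for every $1\leq l\leq m$. A vector $f\in X$ is chain recurrent for $T$ if for every $\delta>0$ there exists a $\delta$-chain for $T$ from $f$ to itself. $CR(T)$ is the set of chain recurrent vectors for $T$; it is always a closed $T$-invariant linear subspace of $X$, so $T\vert_{CR(T)}$ is a continuous linear operator on $CR(T)$ (with the topology and metric inherited from $X$), and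 $CR(T\vert_{CR(T)})$ is its own set of chain recurrent vectors (all chains being contained in $CR(T)$). An operator $T$ is chain recurrent if $CR(T)=X$. *)

(* Defs.v *)
From mathcomp Require Import all_boot all_order all_algebra.
From mathcomp Require Import all_classical all_reals all_analysis.
From mathcomp Require Import complex.

Set Implicit Arguments.
Unset Strict Implicit.
Unset Printing Implicit Defensive.

Import Order.TTheory GRing.Theory Num.Theory.
Import numFieldTopology.Exports.

Local Open Scope classical_set_scope.
Local Open Scope ring_scope.

Variant scalar_kind := real_scalars | complex_scalars.

Definition scalars (R : realType) (s : scalar_kind) : numFieldType :=
  match s with
  | real_scalars => R
  | complex_scalars => R[i]
  end.

Definition modulus (R : realType) (s : scalar_kind) : scalars R s -> R :=
  match s with
  | real_scalars => fun a : R => `|a|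
  | complex_scalars => fun a : R[i] => Normc.normc a
  end.

Variant index_kind := unilateral | bilateral.

(* The unilateral index set {1, 2, ...} is represented by nat, the index n of *)
(* nat standing for n + 1; the shift n |-> n + 1 is unaffected.               *)
Definition shift_index (v : index_kind) : nzSemiRingType :=
  match v with
  | unilateral => nat
  | bilateral => int
  end.

(* Over int, the sum of u over [-m, n[ tends to f as m and n tend to infinity *)
(* independently.                                                             *)
Definition sums_to (X : topologicalZmodType) (v : index_kind) :
    (shift_index v -> X) -> X -> Prop :=
  match v with
  | unilateral => fun (u : nat -> X) f => series u @ \oo --> f
  | bilateral => fun (u : int -> X) f =>
      (fun mn : nat * nat => \sum_(0 <= k < mn.1) u (- (k.+1)%:Z)
                           + \sum_(0 <= k < mn.2) u k%:Z)
        @ filter_prod \oo \oo --> f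
  end.

Definition is_metric (R : realType) (T : Type) (d : T -> T -> R) :=
  [/\ forall x y, d x y = 0 <-> x = y,
      forall x y, d x y = d y x
    & forall x y z, d x z <= d x y + d y z].

Definition completely_metrizable (R : realType) (T : topologicalType) :=
  exists d : T -> T -> R,
    [/\ is_metric d,
        forall x, nbhs x =
          filter_from [set e : R | 0 < e] (fun e => [set y | d x y < e])
      & forall u : nat -> T,
          (forall e : R, 0 < e ->
             exists N, forall m n, (N <= m)%N -> (N <= n)%N ->
               d (u m) (u n) < e) ->
          exists l : T, u @ \oo --> l].

Section SequenceSpaces.
Context (R : realType) (s : scalar_kind) (v : index_kind).
Notation K := (scalars R s).
Notation V := (shift_index v).

(* A space of sequences is given with its canonical embedding iota in K^V:    *)
(* iota f n is the coordinate f(n), and the linear subspace of K^V is the     *)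
(* range of iota. Tvs is the class of locally convex spaces.                  *)
Definition frechet_sequence_space (X : tvsType K)
    (iota : {linear X -> (V -> K^o)}) :=
  [/\ completely_metrizable R X,
      injective iota
    & continuous (iota : X -> {ptws V -> K})].

Definition unit_sequence (n : V) : V -> K := fun m => (m == n)%:R.

(* In a Frechet space the coefficient functionals of such an expansion are    *)
(* automatically continuous.                                                  *)
Definition schauder_basis (X : tvsType K) (e : V -> X) :=
  forall f : X, exists! a : V -> K, sums_to (fun n => a n *: e n) f.

Definition backward_shift (lambda f : V -> K) : V -> K :=
  fun n => lambda (n + 1) * f (n + 1).

Definition is_seminorm (X : lmodType K) (p : X -> R) :=
  [/\ forall f, 0 <= p f,
      forall f g, p (f + g) <= p f + p g
    & forall (a : K) f, p (a *: f) = modulus a * p f].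

(* As the sequence is increasing, its balls are directed, so that no finite   *)
(* intersections are needed. Here p k is the (k + 1)-st seminorm.             *)
Definition inducing_seminorms (X : tvsType K) (p : nat -> X -> R) :=
  [/\ forall k, is_seminorm (p k),
      forall k f, p k f <= p k.+1 f
    & forall f, nbhs f =
        filter_from [set ke : nat * R | 0 < ke.2]
          (fun ke => [set g | p ke.1 (g - f) < ke.2])].

Definition inducing_norm (X : tvsType K) (p : X -> R) :=
  [/\ is_seminorm p,
      forall f, p f = 0 -> f = 0
    & forall f, nbhs f =
        filter_from [set e : R | 0 < e] (fun e => [set g | p (g - f) < e])].

Definition frechet_gauge (X : tvsType K) (p : nat -> X -> R) (f : X) : R :=
  limn (series (fun k => (2 ^+ k.+1)^-1 * Num.min 1 (p k f))).

(* In a Banach space distances are measured by the norm instead.              *)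
Definition gauge_of (X : tvsType K) (p : nat -> X -> R) (gauge : X -> R) :=
  gauge = frechet_gauge p \/ inducing_norm gauge.

End SequenceSpaces.

Arguments unit_sequence R s {v} n m.

Section ChainRecurrence.
Context (R : realType) (Y : Type) (d : Y -> Y -> R) (T : Y -> Y).

Definition is_chain (delta : R) (m : nat) (c : nat -> Y) :=
  forall l, (1 <= l <= m)%N -> d (c l) (T (c l.-1)) < delta.

Definition CR : set Y :=
  [set f | forall delta : R, 0 < delta ->
     exists m c, [/\ (0 < m)%N, c 0%N = f, c m = f & is_chain delta m c]].

Definition chain_recurrent := CR = setT.

End ChainRecurrence.

Definition gauge_dist (R : realType) (X : zmodType) (gauge : X -> R) :
  X -> X -> R := fun f g => gauge (f - g).

Definition restricted_dist (R : realType) (Y : Type) (d : Y -> Y -> R)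
  (A : set Y) : A -> A -> R :=
  fun f g => d (\val f) (\val g).

Arguments restricted_dist {R Y} d A f g.

Definition is_restriction (Y : Type) (T : Y -> Y) (A : set Y) (S : A -> A) :=
  forall f : A, \val (S f) = T (\val f).

(* Main.v *)
Require Import Defs.
From mathcomp Require Import all_boot all_order all_algebra.
From mathcomp Require Import all_classical all_reals all_analysis.
From mathcomp Require Import complex.
From mathcomp Require Import zify ring lra.

Set Implicit Arguments.
Unset Strict Implicit.
Unset Printing Implicit Defensive.

Import Order.TTheory GRing.Theory Num.Theory.
Import numFieldTopology.Exports.

Local Open Scope classical_set_scope.
Local Open Scope ring_scope.

(** Write e_n for the canonical vectors and B for the shift, so that
    B e_n = lambda_n e_(n-1). Chain recurrence of B is decided index by index.
    Call an index n with e_n <> 0 recurrent if, for every delta > 0, there is a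
    finitely supported family of scalars a with a_n = 1 such that every vector
    (a_k - lambda_(k+1) a_(k+1)) e_k is smaller than delta. Such a family, a
    bump, is a delta-chain that enters from 0, passes through e_n and returns
    to 0, all its vectors being multiples of the e_k.

    If f is chain recurrent and f(n) <> 0, then n is recurrent
    ([recurrent_coord]): repeat a loop from f to f periodically, damp it by a
    slowly varying tent weight that vanishes at both ends, and keep from the
    vector at time l its coordinate n - l only. The coordinates move along with
    B, so this is again a chain up to the size of the coordinate projections
    f |-> f(k) e_k, and these are equicontinuous: they are pointwise bounded
    because basis expansions converge, and the uniform boundedness principle
    ([uniformly_bounded_seminorms]) holds in a completely metrizable space.

    If n is recurrent, then so is n + 1, and lambda_(n+1) <> 0; if moreover
    lambda_n <> 0, then n - 1 is recurrent as well. Hence a bump may be cut off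
    outside the recurrent indices without creating an error
    ([bump_restrict]), which closes a loop at e_n through vectors supported by
    the recurrent indices only. Such loops add up ([supported_loops]), so every
    finite combination of the e_n with n recurrent has one. Finally, if f is
    supported by the recurrent indices, then its truncations f' tend to f and
    the B f' tend to B f, as the latter are truncations of the expansion of B f
    ([shift_band]); so the loop at f' can be moved to f by changing its end
    points ([supported_chain]).

    Therefore the chain recurrent vectors are exactly those supported by the
    recurrent indices, and their loops can be chosen among such vectors, which
    is the claim. The unilateral case is treated together with the bilateral one
    by extending vectors, coordinates and weights by zero to all integers. *)

(** * The modulus of a scalar *)

Section Modulus.
Context (R : realType) (s : scalar_kind).
Implicit Types a b : scalars R s.

Lemma modulus_ge0 a : 0 <= modulus a.
Proof.
by case: s a => a; [exact: normr_ge0 | case: a => x y; exact: sqrtr_ge0].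
Qed.

Lemma modulusM a b : modulus (a * b) = modulus a * modulus b.
Proof. by case: s a b => a b; [exact: normrM | exact: Normc.normcM]. Qed.

Lemma modulusN a : modulus (- a) = modulus a.
Proof.
by case: s a => a; [exact: normrN | case: a => x y /=; rewrite !sqrrN].
Qed.

Lemma modulus_eq0 a : modulus a = 0 -> a = 0.
Proof. by case: s a => a; [exact: normr0_eq0 | exact: Normc.eq0_normc]. Qed.

Lemma modulus_nat n : modulus (n%:R : scalars R s) = n%:R.
Proof.
case: s; first exact: normr_nat.
have -> : (n%:R : R[i]) = (n%:R)%:C%C by rewrite rmorph_nat.
by rewrite /= expr0n addr0 sqrtr_sqr normr_nat.
Qed.

Lemma modulusV a : modulus a^-1 = (modulus a)^-1.
Proof.
have [->|a0] := eqVneq a 0; first by rewrite invr0 (modulus_nat 0) invr0.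
have ma0 : modulus a != 0 by apply: contra a0 => /eqP/modulus_eq0 ->.
by apply: (mulfI ma0); rewrite -modulusM !mulfV// (modulus_nat 1).
Qed.

Lemma modulusD a b : modulus (a + b) <= modulus a + modulus b.
Proof. by case: s a b => a b; [exact: ler_normD | exact: le_normcD]. Qed.

Lemma modulus_ball (a : scalars R s) (eps : R) : 0 < eps ->
  nbhs a [set b | modulus (b - a) < eps].
Proof.
move=> e0; case: s a => a.
  apply/nbhs_ballP; exists eps => //= b.
  by rewrite /ball/= distrC.
apply/nbhs_ballP; exists (eps%:C)%C => /=; first by rewrite ltcR.
by move=> b; rewrite /ball/= distrC -ltcR.
Qed.

End Modulus.

(** * Uniform boundedness in completely metrizable spaces *)

Section Baire.
Context (R : realType) (T : topologicalType).

(** By the last hypothesis the balls of radius r n around x n are nested, so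
    x m stays in the N-th one for m >= N; and r n <= r 0 / (n + 1) tends to
    0. *)
Lemma shrinking_balls (d : T -> T -> R) (x : nat -> T) (r : nat -> R) :
  is_metric d ->
  (forall n, 0 < r n) -> (forall n, r n.+1 <= r n / 2) ->
  (forall n z, d (x n.+1) z <= r n.+1 -> d (x n) z < r n) ->
  (forall eps, 0 < eps -> exists N, forall m n, (N <= m)%N -> (N <= n)%N ->
     d (x m) (x n) < eps) /\
  forall N m, (N <= m)%N -> d (x N) (x m) <= r N.
Proof.
move=> [dE dC dT] r0 rS nest.
have nest' N m z : d (x (N + m)%N) z <= r (N + m)%N -> d (x N) z <= r N.
  by elim: m => [|m IH]; rewrite ?addn0// addnS => /nest/ltW.
have dxx z : d z z = 0 by apply/dE.
have near N m : (N <= m)%N -> d (x N) (x m) <= r N.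
  by move=> /subnKC <-; apply: (nest' N (m - N)%N); rewrite dxx; apply/ltW.
split=> // eps e0.
have rn n : r n * n.+1%:R <= r 0%N.
  elim: n => [|n IH]; first by rewrite mulr1.
  apply: le_trans IH; apply: le_trans (ler_wpM2r (ler0n R n.+2) (rS n)) _.
  rewrite -mulrA ler_wpM2l ?(ltW (r0 n))// mulrC ler_pdivrMr// -natrM ler_nat.
  lia.
pose N := Num.bound (r 0%N / (eps / 2)); exists N => m n hm hn.
have N0 : (0 : R) < N.+1%:R by rewrite ltr0n.
have rN : r N < eps / 2.
  have e2 : 0 < eps / 2 by rewrite divr_gt0.
  have := archi_boundP (divr_ge0 (ltW (r0 0%N)) (ltW e2)).
  rewrite -/N ltr_pdivrMr ?divr_gt0// => h.
  rewrite -(ltr_pM2r N0); apply: le_lt_trans (rn N) _; apply: lt_trans h _.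
  by rewrite mulrC ltr_pM2l ?divr_gt0// ltr_nat.
apply: le_lt_trans (dT _ (x N) _) _; rewrite dC [ltRHS]splitr.
by apply: ltrD; apply: le_lt_trans rN; apply: near.
Qed.

(** If no E N had an interior point, nested balls could be chosen, the N-th one
    avoiding E N; their common point would lie in no E N. *)
Lemma baire_category (x0 : T) (E : nat -> set T) :
  completely_metrizable R T ->
  (forall N, closed (E N)) -> (forall x, exists N, E N x) ->
  exists N, exists x : T, nbhs x (E N).
Proof.
move=> [d [dm dnbhs dcomplete]] Ecl Ecov; apply: contrapT => nE.
have [dE dC dT] := dm.
have ball (x : T) r : 0 < r -> nbhs x [set z | d x z < r].
  by move=> r0; rewrite dnbhs; exists r.
have step (q : nat * (T * R)) : exists yr : T * R, 0 < q.2.2 ->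
  [/\ 0 < yr.2, yr.2 <= q.2.2 / 2
    & forall z, d yr.1 z <= yr.2 -> d q.2.1 z < q.2.2 /\ ~ E q.1 z].
  case: q => N [x r] /=; have [r0|r0] := pselect (0 < r); last by exists (x, r).
  have r2 : 0 < r / 2 by rewrite divr_gt0.
  have [y [xy yE]] : exists y, d x y < r / 2 /\ ~ E N y.
    apply: contrapT => h; apply: nE; exists N, x.
    apply: filterS (ball x _ r2) => y xy; apply: contrapT => yE; apply: h.
    by exists y.
  have : nbhs y (~` E N).
    by apply: open_nbhs_nbhs; split=> //; apply: closed_openC.
  rewrite dnbhs => -[t /= t0 tE]; exists (y, Num.min (r / 2) (t / 2)) => _ /=.
  split; first by rewrite lt_min r2 divr_gt0.
    by rewrite ge_min lexx.
  (* The radius r / 2 keeps the ball inside the ball of x, t / 2 off E N. *)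
  move=> z; rewrite le_min => /andP[z1 z2]; split.
    by apply: le_lt_trans (dT _ y _) _; rewrite [ltRHS]splitr ltr_leD.
  by apply: tE; apply: le_lt_trans z2 _; rewrite ltr_pdivrMr// ltr_pMr// ltr1n.
have [F FP] := choice step.
pose st := fix st n : T * R := if n is n'.+1 then F (n', st n') else (x0, 1).
have r0 n : 0 < (st n).2 by elim: n => //= n /(FP (n, st n))[].
have stP n := FP (n, st n) (r0 n).
have [] := @shrinking_balls d (fun n => (st n).1) (fun n => (st n).2) dm r0.
- by move=> n; have [] := stP n.
- by move=> n z; have [_ _ /(_ z)h /h[]] := stP n.
move=> /dcomplete[l xl] near.
have [N El] := Ecov l.
have [_ _ /(_ l)] := stP N; case=> //.
apply/ler_addgt0Pr => eps e0.
have [M _ hM] := xl _ (ball l _ e0).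
have := hM (maxn M N.+1) (leq_maxl _ _) => /= hl.
apply: le_trans (dT _ (st (maxn M N.+1)).1 _) _; apply: lerD.
  by apply: (near N.+1); apply: leq_maxr.
by rewrite dC; apply/ltW.
Qed.

End Baire.

Section UniformBoundedness.
Context (R : realType) (s : scalar_kind) (X : tvsType (scalars R s)).
Context (p : nat -> X -> R).

Lemma seminorm_ge0 (q : X -> R) f : is_seminorm q -> 0 <= q f.
Proof. by case. Qed.

Lemma seminorm0 (q : X -> R) : is_seminorm q -> q 0 = 0.
Proof.
by move=> [_ _ qZ]; rewrite -(scale0r 0) qZ (modulus_nat _ _ 0) mul0r.
Qed.

Lemma seminormMn (q : X -> R) n f : is_seminorm q ->
  q ((n%:R : scalars R s) *: f) = n%:R * q f.
Proof. by move=> [_ _ ->]; rewrite modulus_nat. Qed.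

Lemma seminormN (q : X -> R) f : is_seminorm q -> q (- f) = q f.
Proof.
by move=> [_ _ qZ]; rewrite -scaleN1r qZ modulusN (modulus_nat _ _ 1) mul1r.
Qed.

(** The Banach-Steinhaus theorem. By Baire, some set where all the q i are at
    most N contains a p k-ball around some f0; subtracting f0 bounds the q i by
    2 N on a p k-ball around 0, and homogeneity makes the bound as small as
    desired. *)
Lemma uniformly_bounded_seminorms (I : Type) (q : I -> X -> R) :
  completely_metrizable R X -> inducing_seminorms p ->
  (forall i, is_seminorm (q i)) -> (forall i, continuous (q i)) ->
  (forall f, exists C, forall i, q i f <= C) ->
  forall eps, 0 < eps -> exists k, exists2 eta, 0 < eta &
    forall f, p k f < eta -> forall i, q i f < eps.
Proof.
move=> Xm [psn _ pnbhs] qsn qcont qbd eps e0.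
pose E N := \bigcap_(i in [set: I]) [set f | q i f <= N%:R].
have [||N [f0]] := baire_category 0 (E := E) Xm.
- move=> N; apply: closed_bigI => i _.
  apply: (@closed_comp _ _ (q i) [set r | r <= N%:R]) => [f _|].
    exact: qcont.
  exact: closed_le.
- move=> f; have [C qC] := qbd f; exists (Num.bound `|C|) => i _ /=.
  apply: le_trans (qC i) _; apply: le_trans (ler_norm C) _.
  by apply/ltW/archi_boundP.
rewrite pnbhs => -[[k eta] /= eta0 hE].
have bd f i : p k f < eta -> q i f <= 2 * N%:R.
  move=> pf; have [_ qD _] := qsn i.
  have h1 : q i (f + f0) <= N%:R by apply: hE => //=; rewrite addrK.
  have h2 : q i f0 <= N%:R.
    by apply: hE => //=; rewrite subrr seminorm0.
  have := qD (f + f0) (- f0); rewrite addrK seminormN//; lra.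
pose M := (Num.bound (2 * N%:R / eps)).+1.
have M0 : (0 : R) < M%:R by rewrite ltr0n.
exists k, (eta / M%:R) => [|f]; first exact: divr_gt0.
rewrite ltr_pdivlMr// mulrC -seminormMn// => /bd h i.
have := h i; rewrite seminormMn// => {}h; rewrite -(ltr_pM2l M0).
apply: le_lt_trans h _.
have := archi_boundP (divr_ge0 (mulr_ge0 (ler0n R 2) (ler0n R N)) (ltW e0)).
rewrite ltr_pdivrMr// => h; apply: lt_trans h _.
by rewrite ltr_pM2r// ltr_nat.
Qed.

End UniformBoundedness.

(** * F-norms, and the distances defined by seminorms *)

Section Fnorm.
Context (R : realType) (s : scalar_kind).
Notation K := (scalars R s).
Context (Y : lmodType K).

(** The properties common to a Banach norm and to the bounded gauge built from
    a sequence of seminorms. The latter is not homogeneous, whence the factor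
    max 1 |t| in place of |t|; [Fnorm_divn] is what remains of the continuity
    of scalar multiplication. *)
Record Fnorm (g : Y -> R) : Prop := {
  FnormD : forall x y, g (x + y) <= g x + g y;
  FnormZ : forall (t : K) x, g (t *: x) <= Num.max 1 (modulus t) * g x;
  Fnorm_eq0 : forall x, g x = 0 -> x = 0;
  Fnorm_divn : forall x eps, 0 < eps ->
    exists M0 : nat, forall M, (M0 <= M)%N -> g ((M%:R : K)^-1 *: x) < eps
}.

Context (g : Y -> R) (gF : Fnorm g).

Lemma Fnorm_le1 (t : K) x : modulus t <= 1 -> g (t *: x) <= g x.
Proof.
by move=> t1; apply: le_trans (FnormZ gF t x) _; rewrite max_l// mul1r.
Qed.

Lemma FnormN x : g (- x) = g x.
Proof.
have h z : g (- z) <= g z.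
  by rewrite -scaleN1r; apply: Fnorm_le1; rewrite modulusN (modulus_nat _ _ 1).
by apply/eqP; rewrite eq_le h -{1}(opprK x) h.
Qed.

Lemma FnormB x y : g (x - y) <= g x + g y.
Proof. by rewrite -(FnormN y); apply: FnormD. Qed.

Lemma Fnorm0 : g 0 = 0.
Proof.
have h0 : 0 <= g 0 by have := FnormD gF 0 0; rewrite addr0; lra.
apply/eqP; rewrite eq_le h0 andbT leNgt; apply/negP => h.
have [M0 /(_ _ (leqnn _))] := Fnorm_divn gF 0 h.
by rewrite scaler0 ltxx.
Qed.

Lemma Fnorm_ge0 x : 0 <= g x.
Proof. by have := FnormB x x; rewrite subrr Fnorm0; lra. Qed.

(** The line through a non-zero x carries its usual topology: if |t| >= eps,
    then x = t^-1 (t x) is bounded by a multiple of the size of t x. *)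
Lemma Fnorm_small_coef x eps : x != 0 -> 0 < eps -> exists2 eta, 0 < eta &
  forall t : K, g (t *: x) < eta -> modulus t < eps.
Proof.
move=> x0 e0.
have gx : 0 < g x.
  rewrite lt_def Fnorm_ge0 andbT; apply: contra x0 => /eqP h.
  by rewrite (Fnorm_eq0 gF h).
have c0 : 0 < Num.max 1 eps^-1 by rewrite lt_max ltr01.
exists (g x / Num.max 1 eps^-1); first exact: divr_gt0.
move=> t; rewrite ltr_pdivlMr// => h; rewrite ltNge; apply/negP => et.
have t0 : t != 0.
  by apply/eqP => t0; move: et; rewrite t0 (modulus_nat _ _ 0); lra.
have := FnormZ gF t^-1 (t *: x); rewrite scalerA mulVf// scale1r modulusV.
apply/negP; rewrite -ltNge; apply: le_lt_trans h; rewrite mulrC.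
apply: ler_wpM2l; first exact: Fnorm_ge0.
rewrite ge_max !le_max lexx/= lef_pV2 ?posrE ?et ?orbT//.
exact: lt_le_trans et.
Qed.

Lemma Fnorm_divn_seq (c : nat -> Y) m eps : 0 < eps ->
  exists M0 : nat, forall M, (M0 <= M)%N -> forall l, (l < m)%N ->
    g ((M%:R : K)^-1 *: c l) < eps.
Proof.
move=> e0; elim: m => [|m [M1 h1]]; first by exists 0%N.
have [M2 h2] := Fnorm_divn gF (c m) e0.
exists (maxn M1 M2) => M; rewrite geq_max => /andP[hM1 hM2] l.
rewrite ltnS leq_eqVlt => /orP[/eqP ->|]; first exact: h2.
exact: h1.
Qed.

End Fnorm.

Section Gauge.
Context (R : realType) (s : scalar_kind) (X : tvsType (scalars R s)).
Context (p : nat -> X -> R) (hp : inducing_seminorms p).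
Notation K := (scalars R s).

Let psn k : is_seminorm (p k). Proof. by have [] := hp. Qed.

Let weight (k : nat) : R := (2 ^+ k.+1)^-1.
Let summand f k := weight k * Num.min 1 (p k f).

Let weight_gt0 k : 0 < weight k.
Proof. by rewrite invr_gt0 exprn_gt0. Qed.

Let weight_half k : weight k = (2 ^+ k)^-1 - weight k.
Proof. by rewrite /weight exprS invfM; lra. Qed.

Let summand_ge0 f k : 0 <= summand f k.
Proof.
by rewrite mulr_ge0 ?(ltW (weight_gt0 k))// le_min ler01 seminorm_ge0.
Qed.

Let summand_le f k : summand f k <= weight k.
Proof. by rewrite ler_piMr ?(ltW (weight_gt0 k))// ge_min lexx. Qed.

Let partial_le1 f n : series (summand f) n <= 1 - (2 ^+ n)^-1.
Proof.
elim: n => [|n IH]; first by rewrite seriesEnat/= big_geq// expr0 invr1 subrr.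
rewrite seriesEnat/= big_nat_recr//= -/(series _ _).
have := summand_le f n; rewrite -/(weight n).
by have := weight_half n; rewrite seriesEnat/= in IH; lra.
Qed.

Let partial_nd f : nondecreasing_seq (series (summand f)).
Proof.
by apply/nondecreasing_seqP => n; rewrite !seriesEnat/= big_nat_recr//= lerDl.
Qed.

Let partial_cvg f : cvgn (series (summand f)).
Proof.
apply: nondecreasing_is_cvgn => //; exists 1 => _ [n _ <-].
by apply: le_trans (partial_le1 f n) _; rewrite gerBl invr_ge0 exprn_ge0.
Qed.

Let partial_le f n : series (summand f) n <= frechet_gauge p f.
Proof. exact: nondecreasing_cvgn_le. Qed.

Let gauge_le f C : (forall n, series (summand f) n <= C) ->
  frechet_gauge p f <= C.
Proof. by move=> h; apply: limr_le; [exact: partial_cvg | exact: nearW]. Qed.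

Lemma frechet_gaugeD f g :
  frechet_gauge p (f + g) <= frechet_gauge p f + frechet_gauge p g.
Proof.
apply: gauge_le => n; apply: le_trans (lerD (partial_le f n) (partial_le g n)).
rewrite !seriesEnat/= -big_split/=; apply: ler_sum => k _.
rewrite -mulrDr ler_wpM2l ?(ltW (weight_gt0 k))//.
have [_ pD _] := psn k; have := pD f g.
have := seminorm_ge0 f (psn k); have := seminorm_ge0 g (psn k).
by rewrite /Num.min; do 3?case: ifP; lra.
Qed.

Lemma frechet_gaugeZ (t : K) f :
  frechet_gauge p (t *: f) <= Num.max 1 (modulus t) * frechet_gauge p f.
Proof.
have C0 : 0 <= Num.max 1 (modulus t) by rewrite le_max ler01.
apply: gauge_le => n; apply: le_trans (ler_wpM2l C0 (partial_le f n)).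
rewrite !seriesEnat/= mulr_sumr; apply: ler_sum => k _.
rewrite mulrCA ler_wpM2l ?(ltW (weight_gt0 k))//.
have [_ _ ->] := psn k; rewrite [X in _ <= _ * X]minEle; case: ifP => h.
  by rewrite mulr1 ge_min le_max lexx.
by rewrite ge_min ler_wpM2r ?seminorm_ge0// ?le_max ?lexx orbT.
Qed.

(** The k-th summand alone controls p k. *)
Lemma frechet_gauge_small k eta : 0 < eta -> exists2 eps, 0 < eps &
  forall f, frechet_gauge p f < eps -> p k f < eta.
Proof.
move=> eta0; exists (weight k * Num.min 1 eta) => [|f].
  by rewrite mulr_gt0// lt_min ltr01.
move=> /(le_lt_trans (partial_le f k.+1)).
rewrite seriesEnat/= big_nat_recr//= => h.
have : weight k * Num.min 1 (p k f) < weight k * Num.min 1 eta.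
  by apply: le_lt_trans h; rewrite lerDr sumr_ge0// => i _; apply: summand_ge0.
by rewrite ltr_pM2l// /Num.min; do 2?case: ifP; lra.
Qed.

(** With k large, the summands after k contribute at most 2 ^- k < eps / 2, and
    the first ones at most p k f, since the seminorms increase. *)
Lemma seminorm_small_gauge eps : 0 < eps -> exists k, exists2 eta, 0 < eta &
  forall f, p k f < eta -> frechet_gauge p f < eps.
Proof.
move=> e0; have e2 : 0 < eps / 2 by rewrite divr_gt0.
pose k := Num.bound (eps / 2)^-1; exists k, (eps / 2) => // f pf.
have tail : (2 ^+ k)^-1 < eps / 2.
  rewrite -[ltRHS]invrK ltf_pV2 ?posrE ?invr_gt0 ?exprn_gt0//.
  apply: lt_trans (archi_boundP _) _; first by rewrite invr_ge0 ltW.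
  by rewrite -natrX ltr_nat ltn_expl.
have pnd j : (j <= k)%N -> p j f <= p k f.
  have [_ pS _] := hp; elim: k {pf tail} => [|i IH].
    by rewrite leqn0 => /eqP ->.
  by rewrite leq_eqVlt => /orP[/eqP ->//|/IH h]; apply: le_trans h (pS _ _).
have pk0 := seminorm_ge0 f (psn k).
have head n : (n <= k)%N -> series (summand f) n <= (1 - (2 ^+ n)^-1) * p k f.
  elim: n => [_|n IH nk].
    by rewrite seriesEnat/= big_geq// expr0 invr1 subrr mul0r.
  have := IH (ltnW nk); rewrite !seriesEnat/= big_nat_recr//=.
  have : summand f n <= weight n * p k f.
    rewrite /summand ler_wpM2l ?(ltW (weight_gt0 n))// ge_min pnd ?orbT//.
    exact: ltnW.
  have : weight n * p k f = (2 ^+ n)^-1 * p k f - weight n * p k f.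
    by rewrite -mulrBl -weight_half.
  by rewrite /weight; lra.
have all n : series (summand f) (k + n)%N <=
    p k f + (2 ^+ k)^-1 - (2 ^+ (k + n)%N)^-1.
  elim: n => [|n IH].
    rewrite addn0 addrK; apply: le_trans (head k (leqnn k)) _.
    by rewrite ler_piMl// gerBl invr_ge0 exprn_ge0.
  rewrite addnS seriesEnat/= big_nat_recr//= -/(series _ _).
  have := summand_le f (k + n)%N; have := weight_half (k + n)%N.
  by rewrite seriesEnat/= in IH; rewrite /weight; lra.
have : frechet_gauge p f <= p k f + (2 ^+ k)^-1.
  apply: gauge_le => n; apply: le_trans (partial_nd f (leq_addl k n)) _.
  by apply: le_trans (all n) _; rewrite gerBl invr_ge0 exprn_ge0.
by lra.
Qed.

Context (gauge : X -> R) (hgauge : gauge_of p gauge).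

Lemma gauge_small k eta : 0 < eta -> exists2 eps, 0 < eps &
  forall f, gauge f < eps -> p k f < eta.
Proof.
move: hgauge => [->|[_ _ gnbhs]] eta0; first exact: frechet_gauge_small.
have [_ _ pnbhs] := hp.
have : nbhs (0 : X) [set f | p k (f - 0) < eta].
  by rewrite pnbhs; exists (k, eta).
rewrite gnbhs => -[eps /= eps0 h]; exists eps => // f fe.
by rewrite -(subr0 f); apply: h; rewrite /= subr0.
Qed.

Lemma small_gauge eps : 0 < eps -> exists k, exists2 eta, 0 < eta &
  forall f, p k f < eta -> gauge f < eps.
Proof.
move: hgauge => [->|[_ _ gnbhs]] eps0; first exact: seminorm_small_gauge.
have [_ _ pnbhs] := hp.
have : nbhs (0 : X) [set f | gauge (f - 0) < eps] by rewrite gnbhs; exists eps.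
rewrite pnbhs => -[[k eta] /= eta0 h]; exists k, eta => // f fe.
by rewrite -(subr0 f); apply: h; rewrite /= subr0.
Qed.

(** Definiteness comes from metrizability: the gauge and the metric have the
    same neighbourhoods of 0, and a metric separates points. *)
Lemma gauge_Fnorm : completely_metrizable R X -> Fnorm gauge.
Proof.
move=> [d [[dE dC dT] dnbhs _]]; split.
- by move: hgauge => [->|[[]]//]; exact: frechet_gaugeD.
- move: hgauge => [->|[[g0 _ gZ] _ _]] t f; first exact: frechet_gaugeZ.
  by rewrite gZ ler_wpM2r// le_max lexx orbT.
- move=> f f0; suff : d 0 f <= 0.
    have := dT 0 f 0; rewrite (dE 0 0).2// (dC f 0) => h1 h2.
    by apply/esym/dE; lra.
  rewrite leNgt; apply/negP => df.
  have : nbhs (0 : X) [set y | d 0 y < d 0 f] by rewrite dnbhs; exists (d 0 f).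
  have [_ _ pnbhs] := hp; rewrite pnbhs => -[[k eta] /= eta0 h].
  have [eps eps0 hk] := gauge_small k eta0.
  have /h : p k (f - 0) < eta by rewrite subr0; apply: hk; rewrite f0.
  by rewrite /= ltxx.
- move=> f eps /small_gauge[k [eta eta0 h]].
  exists (Num.bound (p k f / eta)).+1 => M hM; apply: h.
  have M0 : (0 : R) < M%:R by rewrite ltr0n; apply: leq_trans hM.
  have [_ _ ->] := psn k.
  rewrite modulusV modulus_nat mulrC ltr_pdivrMr// mulrC -ltr_pdivrMr//.
  apply: lt_trans (archi_boundP _) _.
    by apply: divr_ge0; [exact: seminorm_ge0 (psn k) | exact: ltW].
  by rewrite ltr_nat.
Qed.

End Gauge.

(** * Chain recurrence of a weighted shift along a sequence of vectors *)

Section ShiftSystem.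
Context (R : realType) (s : scalar_kind).
Notation K := (scalars R s).
Context (Y : lmodType K).

(** The truncation of a two-sided series to the indices from - m to n - 1. The
    two bounds vary independently: shifting moves them in opposite directions.
    *)
Definition band_sum (u : int -> Y) (m n : nat) : Y :=
  \sum_(0 <= k < m) u (- (k.+1)%:Z) + \sum_(0 <= k < n) u k%:Z.

(** A weighted shift along vectors e k with coordinate functions phi k, k
    ranging over the integers. Some of the e k may vanish, which covers a
    one-sided sequence extended by zero; by [coord_neq0] and [weight_neq0] the
    coordinates at such indices, and the weights leading into them, are 0. *)
Record shift_system (g : Y -> R) (B : Y -> Y) (e : int -> Y)
    (phi : int -> Y -> K) (lam : int -> K) : Prop := {
  coordP : forall k a x y, phi k (a *: x + y) = a * phi k x + phi k y;
  shiftP : forall a x y, B (a *: x + y) = a *: B x + B y;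
  coord_shift : forall k x, phi k (B x) = lam (k + 1) * phi (k + 1) x;
  shift_unit : forall k, B (e k) = lam k *: e (k - 1);
  coord_unit : forall j k, j != k -> phi j (e k) = 0;
  coord_neq0 : forall k x, phi k x != 0 -> e k != 0;
  weight_neq0 : forall k, lam k != 0 -> e (k - 1) != 0;
  equicontinuous_coord : forall eps, 0 < eps -> exists2 eta, 0 < eta &
    forall x, g x < eta -> forall k, g (phi k x *: e k) < eps;
  unit_expansion : forall x eps, 0 < eps -> exists N : nat, forall m n,
    (N <= m)%N -> (N <= n)%N ->
    g (band_sum (fun k => phi k x *: e k) m n - x) < eps
}.

Context (g : Y -> R) (B : Y -> Y) (e : int -> Y) (phi : int -> Y -> K).
Context (lam : int -> K).
Hypotheses (gF : Fnorm g) (sys : shift_system g B e phi lam).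

Local Notation dist := (gauge_dist g).

(** A chain of multiples of the e k that leaves 0 and returns to 0, read by
    decreasing k: it visits a k *: e k, and is at e n when k = n. *)
Definition bump (n : int) (delta : R) (a : int -> K) :=
  [/\ a n = 1,
      exists M : nat, forall k, (M <= `|k - n|)%N -> a k = 0
    & forall k, g ((a k - lam (k + 1) * a (k + 1)) *: e k) < delta].

Definition recurrent_index : set int :=
  [set n | e n != 0 /\ forall delta, 0 < delta -> exists a, bump n delta a].

Definition recurrent_support : set Y :=
  [set f | forall n, phi n f != 0 -> recurrent_index n].

Lemma shift0 : B 0 = 0.
Proof.
by have := shiftP sys (-1) 0 0; rewrite scaler0 addr0 scaleN1r addNr.
Qed.

Lemma shiftD x y : B (x + y) = B x + B y.
Proof. by have := shiftP sys 1 x y; rewrite !scale1r. Qed.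

Lemma shiftZ a x : B (a *: x) = a *: B x.
Proof. by have := shiftP sys a x 0; rewrite !addr0 shift0 addr0. Qed.

Lemma coord0 k : phi k 0 = 0.
Proof.
by have := coordP sys k (-1) 0 0; rewrite scaler0 addr0 mulN1r addNr.
Qed.

Lemma coordD k x y : phi k (x + y) = phi k x + phi k y.
Proof. by have := coordP sys k 1 x y; rewrite !scale1r mul1r. Qed.

Lemma coordZ k a x : phi k (a *: x) = a * phi k x.
Proof. by have := coordP sys k a x 0; rewrite !addr0 coord0 addr0. Qed.

Lemma coordB k x y : phi k (x - y) = phi k x - phi k y.
Proof. by rewrite -scaleN1r addrC (coordP sys) mulN1r addrC. Qed.

(** It suffices to find families whose n-th entries are bounded away from 0
    uniformly in delta: dividing by that entry enlarges the errors by a bounded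
    factor. *)
Lemma bump_rescale n (c : K) eps : 0 < eps -> c != 0 ->
  (forall delta, 0 < delta -> exists a : int -> K,
    [/\ modulus c <= modulus (a n),
      exists M : nat, forall k, (M <= `|k - n|)%N -> a k = 0
    & forall k, g ((a k - lam (k + 1) * a (k + 1)) *: e k) < delta]) ->
  exists a, bump n eps a.
Proof.
move=> e0 c0 h.
have mc0 : 0 < modulus c.
  by rewrite lt_def modulus_ge0 andbT; apply: contra c0 => /eqP/modulus_eq0 ->.
set C := Num.max 1 (modulus c)^-1.
have C0 : 0 < C by rewrite lt_max ltr01.
have [a [ca [M aM] ae]] := h _ (divr_gt0 e0 C0).
have man0 := lt_le_trans mc0 ca.
have an0 : a n != 0.
  by apply/eqP => z; move: man0; rewrite z (modulus_nat _ _ 0) ltxx.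
exists (fun k => (a n)^-1 * a k); split; first by rewrite mulVf.
  by exists M => k /aM ->; rewrite mulr0.
move=> k; rewrite mulrCA -mulrBr -scalerA; apply: le_lt_trans (FnormZ gF _ _) _.
have := ae k; rewrite ltr_pdivlMr// => h'; apply: le_lt_trans h'.
rewrite mulrC ler_wpM2l ?(Fnorm_ge0 gF)// modulusV ge_max !le_max lexx/=.
by rewrite lef_pV2 ?posrE// ca orbT.
Qed.

Lemma bump_near n (eps : R) : e n != 0 -> 0 < eps -> exists2 eta, 0 < eta &
  forall a, (forall k, g ((a k - lam (k + 1) * a (k + 1)) *: e k) < eta) ->
    modulus (a n - lam (n + 1) * a (n + 1)) < eps.
Proof.
move=> en e0; have [eta eta0 h] := Fnorm_small_coef gF en e0.
by exists eta => // a /(_ n)/h.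
Qed.

(** As a n = 1 and the error at n is small, lam (n + 1) * a (n + 1) is close to
    1; so the bump at n, divided by a (n + 1), is a bump at n + 1. *)
Lemma recurrent_indexS n : recurrent_index n ->
  lam (n + 1) != 0 /\ recurrent_index (n + 1).
Proof.
move=> [en hn].
have h2 : (0 : R) < 2^-1 by rewrite invr_gt0 ltr0n.
have [eta eta0 heta] := bump_near en h2.
have key a d : 0 < d -> d <= eta -> bump n d a ->
    2^-1 <= modulus (lam (n + 1)) * modulus (a (n + 1)).
  move=> d0 deta [an _ ae].
  have /heta : forall k, g ((a k - lam (k + 1) * a (k + 1)) *: e k) < eta.
    by move=> k; apply: lt_le_trans (ae k) deta.
  rewrite an => h.
  have := modulusD (1 - lam (n + 1) * a (n + 1)) (lam (n + 1) * a (n + 1)).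
  rewrite subrK (modulus_nat _ _ 1) -modulusM; lra.
have l0 : lam (n + 1) != 0.
  have [a ba] := hn _ eta0; have := key _ _ eta0 (lexx _) ba.
  by apply: contraTneq => ->; rewrite (modulus_nat _ _ 0) mul0r -ltNge.
have ml0 : 0 < modulus (lam (n + 1)).
  by rewrite lt_def modulus_ge0 andbT; apply: contra l0 => /eqP/modulus_eq0 ->.
split=> //; split.
  apply/eqP => en1; have := shift_unit sys (n + 1).
  rewrite en1 shift0 addrK => /esym/eqP; rewrite scaler_eq0 (negbTE l0).
  by rewrite (negbTE en).
move=> delta d0; apply: (@bump_rescale _ (2%:R * lam (n + 1))^-1) => //.
  by rewrite invr_eq0 mulf_neq0// pnatr_eq0.
move=> d dpos; have m0 : 0 < Num.min d eta by rewrite lt_min dpos.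
have [md me] : Num.min d eta <= d /\ Num.min d eta <= eta.
  by rewrite !ge_min !lexx orbT.
have [a ba] := hn _ m0; exists a; split.
- have := key _ _ m0 me ba.
  rewrite modulusV modulusM modulus_nat invfM => h.
  by rewrite ler_pdivrMr// mulrC.
- have [_ [M aM] _] := ba; exists M.+1 => k kM; apply: aM; lia.
- move=> k; have [_ _ /(_ k) h] := ba; exact: lt_le_trans h md.
Qed.

(** The error at n - 1 being small, a (n - 1) is close to lam n <> 0; so the
    bump at n, divided by a (n - 1), is a bump at n - 1. *)
Lemma recurrent_indexP n : recurrent_index n -> lam n != 0 ->
  recurrent_index (n - 1).
Proof.
move=> [en hn] l0; have en1 := weight_neq0 sys l0; split=> // delta d0.
have ml0 : 0 < modulus (lam n).
  by rewrite lt_def modulus_ge0 andbT; apply: contra l0 => /eqP/modulus_eq0 ->.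
have ml20 : 0 < modulus (lam n) / 2 by rewrite divr_gt0.
have [eta eta0 heta] := bump_near en1 ml20.
apply: (@bump_rescale _ (lam n / 2%:R)) => //.
  by rewrite mulf_neq0// invr_eq0 pnatr_eq0.
move=> d dpos; have m0 : 0 < Num.min d eta by rewrite lt_min dpos.
have [md me] : Num.min d eta <= d /\ Num.min d eta <= eta.
  by rewrite !ge_min !lexx orbT.
have [a [an [M aM] ae]] := hn _ m0; exists a; split.
- have /heta : forall k, g ((a k - lam (k + 1) * a (k + 1)) *: e k) < eta.
    by move=> k; apply: lt_le_trans (ae k) me.
  rewrite subrK an mulr1 => h.
  have := modulusD (- (a (n - 1) - lam n)) (a (n - 1)).
  by rewrite opprB subrK -opprB modulusN modulusM modulusV modulus_nat; lra.
- exists M.+1 => k kM; apply: aM; lia.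
- by move=> k; apply: lt_le_trans (ae k) md.
Qed.

(** A loop at f repeated in both directions of time; the finitely many vectors
    of the loop are recorded as the range of c'. *)
Lemma periodic_chain f eta : CR dist B f -> 0 < eta ->
  exists (c : int -> Y) (c' : nat -> Y) (m : nat),
    [/\ c 0 = f, forall x, g (c x - B (c (x - 1))) < eta
      & forall x, exists2 l, (l < m)%N & c x = c' l].
Proof.
move=> ff eta0; have [m [c [m0 c0 cm cc]]] := ff _ eta0.
have mz : m%:Z != 0 by lia.
exists (fun x => c `|(x %% m)%Z|%N), c, m; split.
- by rewrite mod0z.
- move=> x; have r0 := modz_ge0 x mz.
  have rm : (x %% m)%Z < m by rewrite -[ltRHS]/(`|m%:Z|%N%:Z) ltz_mod.
  have [z|nz] := eqVneq (x %% m)%Z 0.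
    have -> : ((x - 1) %% m)%Z = m%:Z - 1.
      rewrite (divz_eq x m) z addr0.
      have -> : (x %/ m)%Z * m%:Z - 1 =
        ((x %/ m)%Z - 1) * m%:Z + (m%:Z - 1) by ring.
      by rewrite modzMDl modz_small//; lia.
    rewrite z absz0 c0 -cm; have -> : `|m%:Z - 1|%N = m.-1 by lia.
    by apply: cc; lia.
  have -> : ((x - 1) %% m)%Z = (x %% m)%Z - 1.
    rewrite [in LHS](divz_eq x m) -addrA modzMDl modz_small//; lia.
  have -> : `|(x %% m)%Z - 1|%N = (`|(x %% m)%Z|%N).-1 by lia.
  by apply: cc; lia.
- move=> x; exists `|(x %% m)%Z|%N => //.
  have r0 := modz_ge0 x mz.
  have rm : (x %% m)%Z < m by rewrite -[ltRHS]/(`|m%:Z|%N%:Z) ltz_mod.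
  lia.
Qed.

(** Up to the factor phi n f, the bump at n is the tent weight w k / M times
    the coordinate k of the periodic chain at time n - k. Its error at k is the
    coordinate k of the vector v below: the damped error of the chain, plus a
    vector of the shape t B c / M with |t| <= 1, due to the variation of the
    weight. *)
Lemma recurrent_coord f n : CR dist B f -> phi n f != 0 -> recurrent_index n.
Proof.
move=> ff t0; split; first exact: (coord_neq0 sys) t0.
move=> delta d0; apply: (bump_rescale d0 t0) => eps eps0.
have [eta eta0 heta] := equicontinuous_coord sys eps0.
have eta2 : 0 < eta / 2 by rewrite divr_gt0.
have [c [c' [m [c0 cc cfin]]]] := periodic_chain ff eta2.
have [M0 hM0] := Fnorm_divn_seq gF (fun l => B (c' l)) m eta2.
pose M := M0.+1; pose w k : K := (M - `|k - n|)%:R.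
have M_neq0 : (M%:R : K) != 0 by rewrite pnatr_eq0.
exists (fun k => w k / M%:R * phi k (c (n - k))); split.
- by rewrite /w subrr absz0 subn0 divff// mul1r c0.
- exists M => k kM; rewrite /w (_ : (M - _)%N = 0%N) ?mul0r//; lia.
move=> k; pose v := (w k / M%:R) *: (c (n - k) - B (c (n - k - 1))) +
  (w k - w (k + 1)) *: (M%:R^-1 *: B (c (n - k - 1))).
rewrite (_ : _ - _ = phi k v); last first.
  rewrite /v coordD !coordZ coordB (coord_shift sys) opprD addrA; ring.
apply: heta; apply: le_lt_trans (FnormD gF _ _) _.
rewrite [ltRHS]splitr; apply: ler_ltD.
  apply/ltW; apply: le_lt_trans (cc (n - k)); apply: (Fnorm_le1 gF).
  rewrite modulusM modulusV !modulus_nat ler_pdivrMr ?ltr0n// mul1r.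
  by rewrite ler_nat; lia.
have [l lm ->] := cfin (n - k - 1).
apply: le_lt_trans (hM0 M (leqnSn _) l lm); apply: (Fnorm_le1 gF).
rewrite /w; set u := (M - _)%N; set u' := (M - _)%N.
have [E|[E|E]] : u = u' \/ u = u'.+1 \/ u' = u.+1 by lia.
- by rewrite E subrr (modulus_nat _ _ 0).
- by rewrite E -natr1 addrC addKr (modulus_nat _ _ 1).
- by rewrite E -natr1 opprD addNKr modulusN (modulus_nat _ _ 1).
Qed.

Lemma recurrent_support0 : recurrent_support 0.
Proof. by move=> n; rewrite coord0 eqxx. Qed.

Lemma recurrent_supportD x y :
  recurrent_support x -> recurrent_support y -> recurrent_support (x + y).
Proof.
move=> hx hy n; rewrite coordD; have [x0|x0 _] := eqVneq (phi n x) 0.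
  by rewrite x0 add0r; apply: hy.
exact: hx.
Qed.

Lemma recurrent_supportZ a x :
  recurrent_support x -> recurrent_support (a *: x).
Proof. by move=> hx n; rewrite coordZ mulf_eq0 negb_or => /andP[_ /hx]. Qed.

Lemma recurrent_support_unit n : recurrent_index n -> recurrent_support (e n).
Proof.
by move=> hn j; have [->//|jn] := eqVneq j n; rewrite (coord_unit sys jn) eqxx.
Qed.

Lemma recurrent_support_shift x :
  recurrent_support x -> recurrent_support (B x).
Proof.
move=> hx n; rewrite (coord_shift sys) mulf_eq0 negb_or => /andP[l0 /hx h].
by have := recurrent_indexP h l0; rewrite addrK.
Qed.

(** Cutting off can create an error only at a pair k, k + 1 exactly one of
    which is recurrent. That only k is contradicts [recurrent_indexS]; if only
    k + 1 is, then lam (k + 1) = 0 by [recurrent_indexP], and the error is 0. *)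
Lemma bump_restrict n delta a : recurrent_index n -> bump n delta a ->
  exists2 a', bump n delta a' & forall k, ~ recurrent_index k -> a' k = 0.
Proof.
move=> hn [an [M aM] ae].
pose a' k := if `[< recurrent_index k >] then a k else 0.
have a'in k : recurrent_index k -> a' k = a k by rewrite /a' => /asboolT ->.
have a'out k : ~ recurrent_index k -> a' k = 0 by rewrite /a' => /asboolF ->.
exists a' => //; split; first by rewrite a'in.
  by exists M => k /aM; rewrite /a'; case: ifP.
move=> k; have d0 : 0 < delta := le_lt_trans (Fnorm_ge0 gF _) (ae k).
have [hk|hk] := pselect (recurrent_index k).
  by rewrite !a'in//; have [] := recurrent_indexS hk.
rewrite (a'out _ hk) sub0r.
suff -> : lam (k + 1) * a' (k + 1) = 0 by rewrite oppr0 scale0r (Fnorm0 gF).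
have [l0|l0] := eqVneq (lam (k + 1)) 0; first by rewrite l0 mul0r.
rewrite a'out ?mulr0// => hk1; apply: hk.
by have := recurrent_indexP hk1 l0; rewrite addrK.
Qed.

(** The loops are required in all large lengths, so that loops at two vectors
    can be given the same length and added. *)
Definition supported_loops (f : Y) := forall eta, 0 < eta ->
  exists M0 : nat, forall M, (M0 <= M)%N -> exists c : nat -> Y,
    [/\ c 0%N = f, c M = f, is_chain dist B eta M c
      & forall l, recurrent_support (c l)].

Lemma supported_loops0 : supported_loops 0.
Proof.
move=> eta eta0; exists 0%N => M _; exists (fun=> 0); split=> // [l _|l].
  by rewrite /gauge_dist shift0 subr0 (Fnorm0 gF).
exact: recurrent_support0.
Qed.

Lemma supported_loopsD x y :
  supported_loops x -> supported_loops y -> supported_loops (x + y).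
Proof.
move=> hx hy eta eta0; have eta2 : 0 < eta / 2 by rewrite divr_gt0.
have [M1 h1] := hx _ eta2; have [M2 h2] := hy _ eta2.
exists (maxn M1 M2) => M; rewrite geq_max => /andP[/h1 [c [c0 cM cc cW]]].
move=> /h2 [c' [c'0 c'M cc' cW']]; exists (fun l => c l + c' l).
split=> [||l lM|l].
- by rewrite c0 c'0.
- by rewrite cM c'M.
- rewrite /gauge_dist shiftD opprD addrACA.
  apply: le_lt_trans (FnormD gF _ _) _.
  by rewrite [ltRHS]splitr ltrD// ?cc ?cc'.
- exact: recurrent_supportD.
Qed.

Lemma supported_loopsZ a x : supported_loops x -> supported_loops (a *: x).
Proof.
move=> hx eta eta0; set C := Num.max 1 (modulus a).
have C0 : 0 < C by rewrite lt_max ltr01.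
have [M0 h0] := hx _ (divr_gt0 eta0 C0).
exists M0 => M /h0 [c [c0 cM cc cW]]; exists (fun l => a *: c l).
split=> [||l lM|l]; rewrite ?c0 ?cM//; last exact: recurrent_supportZ.
rewrite /gauge_dist shiftZ -scalerBr; apply: le_lt_trans (FnormZ gF _ _) _.
by rewrite mulrC -ltr_pdivlMr//; apply: cc.
Qed.

(** Two copies of the bump are superposed, one leaving e n at time 0 and one
    arriving there at time M; M exceeds the radius of the support of the bump,
    so that each copy vanishes at the time when the other one is at e n. *)
Lemma supported_loops_unit n : recurrent_index n -> supported_loops (e n).
Proof.
move=> hn eta eta0; have eta2 : 0 < eta / 2 by rewrite divr_gt0.
have [a0 /(bump_restrict hn)[a [an [M0 aM] ae] aS]] := hn.2 _ eta2.
pose piece k := a k *: e k.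
have pieceW k : recurrent_support (piece k).
  have [hk|/aS ak] := pselect (recurrent_index k).
    exact/recurrent_supportZ/recurrent_support_unit.
  by rewrite /piece ak scale0r; apply: recurrent_support0.
have pieceB k : g (piece (k - 1) - B (piece k)) < eta / 2.
  have := ae (k - 1); rewrite subrK.
  by rewrite /piece shiftZ (shift_unit sys) scalerA -scalerBl [lam k * _]mulrC.
exists M0.+1 => M hM.
exists (fun l => piece (n - l%:Z) + piece (n + M%:Z - l%:Z)).
split=> [||l lM|l].
- rewrite !subr0 /piece an scale1r aM ?scale0r ?addr0//; lia.
- rewrite addrK /piece an scale1r aM ?scale0r ?add0r//; lia.
- rewrite /gauge_dist shiftD opprD addrACA.
  apply: le_lt_trans (FnormD gF _ _) _.
  have h z : z - l%:Z = (z - (l.-1)%:Z) - 1 by lia.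
  by rewrite !h [ltRHS]splitr ltrD.
- exact: recurrent_supportD.
Qed.

Lemma supported_loops_band f m n : recurrent_support f ->
  supported_loops (band_sum (fun k => phi k f *: e k) m n).
Proof.
move=> hf; have loopk k : supported_loops (phi k f *: e k).
  have [->|/hf hk] := eqVneq (phi k f) 0.
    by rewrite scale0r; apply: supported_loops0.
  exact/supported_loopsZ/supported_loops_unit.
apply: supported_loopsD; apply: big_ind => //;
  do ?[exact: supported_loops0 | exact: supported_loopsD].
Qed.

(** B maps the term of index k to the term of index k - 1 in the expansion of B
    f, so both bounds move by one. *)
Lemma shift_band f m n : B (band_sum (fun k => phi k f *: e k) m n.+1) =
  band_sum (fun k => phi k (B f) *: e k) m.+1 n.
Proof.
have Bsum (I : Type) (r : seq I) (F : I -> Y) :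
  B (\sum_(i <- r) F i) = \sum_(i <- r) B (F i).
  by apply: (big_morph B shiftD shift0).
have term k : B (phi k f *: e k) = phi (k - 1) (B f) *: e (k - 1).
  by rewrite shiftZ (shift_unit sys) scalerA (coord_shift sys) subrK mulrC.
rewrite /band_sum shiftD !Bsum big_nat_recl// [in RHS]big_nat_recl//.
rewrite addrCA addrA term; congr (_ + _ + _).
- by apply: eq_bigr => k _; rewrite term; congr (phi _ _ *: e _); lia.
- by apply: eq_bigr => k _; rewrite term; congr (phi _ _ *: e _); lia.
Qed.

(** Take a loop at a truncation f' of f, of length at least 2, and replace its
    two end points by f. The first error changes by B f' - B f and the last one
    by f - f', both of which are small. *)
Lemma supported_chain f delta : recurrent_support f -> 0 < delta ->
  exists m c, [/\ (0 < m)%N, c 0%N = f, c m = f, is_chain dist B delta m c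
                & forall l, recurrent_support (c l)].
Proof.
move=> hf d0; have d3 : 0 < delta / 3 by rewrite divr_gt0.
have [N1 h1] := unit_expansion sys f d3.
have [N2 h2] := unit_expansion sys (B f) d3.
set N := maxn N1 N2; set f' := band_sum (fun k => phi k f *: e k) N N.+1.
have f'f : g (f' - f) < delta / 3.
  by apply: h1; rewrite /N ?leqW// leq_maxl.
have Bf'f : g (B f' - B f) < delta / 3.
  by rewrite shift_band; apply: h2; rewrite /N ?leqW// leq_maxr.
have [M0 /(_ _ (leq_addr 2 _)) [c [c0 cM cc cW]]] :=
  supported_loops_band N N.+1 hf d3.
set M := (M0 + 2)%N in cM cc.
exists M, (fun l => if (l == 0%N) || (l == M) then f else c l); split=> //.
- lia.
- by rewrite eqxx orbT.
- move=> l /andP[l1 lM]; rewrite /gauge_dist.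
  have -> : (l == 0%N) = false by lia.
  have -> : (l.-1 == M) = false by lia.
  rewrite orbF /=; have := cc l; rewrite l1 lM => /(_ isT).
  rewrite /gauge_dist => cl; have [lE|lE] := eqVneq l M.
    have -> : (l.-1 == 0%N) = false by lia.
    rewrite -(subrK f' f) -addrA; apply: le_lt_trans (FnormD gF _ _) _.
    have clf : c l = f' by rewrite lE.
    by move: f'f; rewrite clf in cl; rewrite -(FnormN gF (f' - f)) opprB; lra.
  have [l0|l0] := eqVneq l.-1 0%N; last by lra.
  rewrite l0 c0 in cl; rewrite -(subrK (B f') (c l)) -addrA.
  by apply: le_lt_trans (FnormD gF _ _) _; lra.
- by move=> l; case: ifP.
Qed.

Lemma CR_support : CR dist B = recurrent_support.
Proof.
apply/seteqP; split=> [f ff n|f hf delta d0]; first exact: recurrent_coord.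
by have [m [c [? ? ? ? _]]] := supported_chain hf d0; exists m, c.
Qed.

(** The loops of [supported_chain] consist of chain recurrent vectors, by
    [CR_support]; so they are loops of the restricted map. *)
Theorem CR_restriction : exists S : CR dist B -> CR dist B,
  is_restriction B S /\
  chain_recurrent (restricted_dist dist (CR dist B)) S.
Proof.
have inW (f : CR dist B) : recurrent_support (\val f).
  by rewrite -CR_support; exact: set_valP.
have inCR x : recurrent_support x -> x \in CR dist B.
  by rewrite CR_support => /mem_set.
pose stab f := inCR _ (recurrent_support_shift (inW f)).
exists (fun f => SigSub (stab f)); split=> //.
apply/seteqP; split=> // f _ delta d0.
have [m [c [m0 c0 cm cc cW]]] := supported_chain (inW f) d0.
exists m, (fun l => SigSub (inCR _ (cW l))); split=> //; exact/val_inj.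
Qed.

End ShiftSystem.

(** * Sequence spaces as weighted shifts indexed by the integers *)

Section Extension.
Context (T : Type) (z : T).

Definition int_extension (v : index_kind) :
    (shift_index v -> T) -> int -> T :=
  match v with
  | unilateral => fun u k => if k is Posz n then u n else z
  | bilateral => fun u => u
  end.

(** At index 0 the unilateral weight is replaced by z as well: the shift sends
    the first canonical vector to 0. *)
Definition weight_extension (v : index_kind) :
    (shift_index v -> T) -> int -> T :=
  match v with
  | unilateral => fun u k => if k is Posz n.+1 then u n.+1 else z
  | bilateral => fun u => u
  end.

End Extension.

Lemma embeddingZ (R : realType) (s : scalar_kind) (V : Type)
  (X : lmodType (scalars R s)) (iota : {linear X -> (V -> (scalars R s)^o)})
  (a : scalars R s) x n : iota (a *: x) n = a * iota x n.
Proof. by rewrite linearZ. Qed.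

Section SequenceSpace.
Context (R : realType) (s : scalar_kind) (v : index_kind).
Notation K := (scalars R s).
Notation V := (shift_index v).
Context (X : tvsType K) (iota : {linear X -> (V -> K^o)}).
Hypothesis hX : frechet_sequence_space iota.
Context (e : V -> X) (he : forall n, iota (e n) = unit_sequence R s n).
Hypothesis hbasis : schauder_basis e.
Context (p : nat -> X -> R) (hp : inducing_seminorms p).

Definition unit_ext : int -> X := int_extension 0 e.
Definition coord_ext (k : int) (f : X) : K := int_extension 0 (iota f) k.

Lemma sums_to_band (u : V -> X) f : sums_to u f -> forall A, nbhs f A ->
  exists N : nat, forall m n, (N <= m)%N -> (N <= n)%N ->
    A (band_sum (int_extension 0 u) m n).
Proof.
case: v u => u /= h A /h.
  move=> [N _ hN]; exists N => m n _ Nn; have := hN n Nn.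
  by rewrite /= seriesEnat /band_sum [X in X + _]big1 ?add0r.
move=> [[P Q] [[N1 _ h1] [N2 _ h2]] hPQ]; exists (maxn N1 N2) => m n.
rewrite !geq_max => /andP[m1 _] /andP[_ n2].
by apply: (hPQ (m, n)); split; [apply: h1 | apply: h2].
Qed.

Lemma coord_linear k a x y :
  coord_ext k (a *: x + y) = a * coord_ext k x + coord_ext k y.
Proof.
rewrite /coord_ext; case: v iota k => io [n|n] /=; rewrite ?linearP//.
by rewrite mulr0 addr0.
Qed.

Lemma coord_ext0 k : coord_ext k 0 = 0.
Proof.
by have := coord_linear k (-1) 0 0; rewrite scaler0 addr0 mulN1r addNr.
Qed.

Lemma coord_extD k x y : coord_ext k (x + y) = coord_ext k x + coord_ext k y.
Proof. by have := coord_linear k 1 x y; rewrite scale1r mul1r. Qed.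

Lemma coord_extZ k a x : coord_ext k (a *: x) = a * coord_ext k x.
Proof. by have := coord_linear k a x 0; rewrite !addr0 coord_ext0 addr0. Qed.

Lemma coord_ext_unit j k : j != k -> coord_ext j (unit_ext k) = 0.
Proof.
rewrite /coord_ext /unit_ext.
case: v iota e he j k => io ee hh [j|j] [k|k] //= jk;
  rewrite ?raddf0// hh /unit_sequence (_ : (_ == _) = false)//; exact: negbTE.
Qed.

Lemma coord_ext_diag k f : coord_ext k f != 0 ->
  coord_ext k (unit_ext k) = 1.
Proof.
rewrite /coord_ext /unit_ext; case: v iota e he k => io ee hh [k|k] //=;
  by rewrite ?eqxx// => _; rewrite hh /unit_sequence eqxx.
Qed.

Lemma coord_ext_continuous k f eps : 0 < eps ->
  nbhs f [set g | modulus (coord_ext k g - coord_ext k f) < eps].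
Proof.
move=> e0; have [_ _ ic] := hX.
have main n : nbhs f [set g | modulus ((iota g n : K) - iota f n) < eps].
  have c : continuous (fun g => (iota g n : K)).
    move=> g; apply: (@continuous_comp _ _ _ (iota : X -> {ptws V -> K})
      (fun h : {ptws V -> K} => h n)); first exact: ic.
    exact: (@proj_continuous V (fun=> K) n).
  exact: (c f _ (modulus_ball (iota f n : K) e0)).
have triv : nbhs f [set g : X | modulus ((0 : K) - 0) < eps].
  by apply: filterE => g /=; rewrite subr0 (modulus_nat _ _ 0).
rewrite /coord_ext; move: triv main; clear.
by case: v iota k => io [n|n] //= _ h; exact: h.
Qed.

Lemma coord_band (b : int -> K) j m n : coord_ext j (unit_ext j) = 1 ->
  (`|j| < m)%N -> (`|j| < n)%N ->
  coord_ext j (band_sum (fun k => b k *: unit_ext k) m n) = b j.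
Proof.
move=> j1 jm jn.
have csum (r : seq nat) (h : nat -> int) :
    coord_ext j (\sum_(i <- r) b (h i) *: unit_ext (h i)) =
    \sum_(i <- r | h i == j) b j.
  rewrite (big_morph _ (coord_extD j) (coord_ext0 j)) [RHS]big_mkcond/=.
  apply: eq_bigr => i _; rewrite coord_extZ.
  have [->|hj] := eqVneq (h i) j; first by rewrite j1 mulr1.
  by rewrite coord_ext_unit ?mulr0// eq_sym.
rewrite /band_sum coord_extD (csum _ (fun k => - (k.+1)%:Z)) (csum _ Posz).
case: j jm jn {j1 csum} => j jm jn.
  by rewrite big_pred0// add0r (big_nat1_eq _ (fun=> b (Posz j)) j 0 n) jn.
rewrite [X in _ + X]big_pred0// addr0.
by rewrite (big_nat1_eq _ (fun=> b (Negz j)) j 0 m) (ltnW jm).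
Qed.

(** The coefficients of the expansion of f are its coordinates, because
    coordinates are continuous and those of the truncations are eventually the
    coefficients. *)
Lemma basis_expansion f A : nbhs f A -> exists N : nat, forall m n,
  (N <= m)%N -> (N <= n)%N ->
  A (band_sum (fun k => coord_ext k f *: unit_ext k) m n).
Proof.
have [a [af _]] := hbasis f.
have extE : int_extension 0 (fun n => a n *: e n) =
    (fun k => int_extension 0 a k *: unit_ext k).
  rewrite funeqE /unit_ext; clear; case: v a e => a ee [k|k] //=.
  by rewrite scale0r.
have coef : (fun k => int_extension 0 a k *: unit_ext k) =
    (fun k => coord_ext k f *: unit_ext k).
  rewrite funeqE => k; have [z|] := eqVneq (coord_ext k (unit_ext k)) 0.
    suff -> : unit_ext k = 0 by rewrite !scaler0.
    move: z; rewrite /coord_ext /unit_ext.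
    clear -he; case: v iota e he k => io ee hh [k|k] //=;
    by rewrite hh /unit_sequence eqxx => /eqP; rewrite oner_eq0.
  move=> /coord_ext_diag k1; congr (_ *: _); apply/eqP; rewrite -subr_eq0.
  apply/eqP/modulus_eq0/eqP; rewrite eq_le modulus_ge0 andbT.
  apply/ler_addgt0Pl => eps e0; rewrite addr0; apply/ltW.
  have [N hN] := sums_to_band af (coord_ext_continuous k f e0).
  have := hN (maxn N `|k|.+1) (maxn N `|k|.+1) (leq_maxl _ _) (leq_maxl _ _).
  by rewrite /= extE coord_band// leq_maxr.
by move=> /(sums_to_band af); rewrite extE coef.
Qed.

Lemma coord_proj_seminorm k i :
  is_seminorm (fun f => p k (coord_ext i f *: unit_ext i)).
Proof.
have [_ pD pZ] : is_seminorm (p k) by have [] := hp.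
split=> [f|f g|a f]; first by apply: (seminorm_ge0 (q := p k)); have [] := hp.
  by rewrite coord_extD scalerDl.
by rewrite coord_extZ -scalerA pZ.
Qed.

Lemma coord_proj_continuous k i :
  continuous (fun f => p k (coord_ext i f *: unit_ext i)).
Proof.
move=> f; have [c0 _ pZ] : is_seminorm (p k) by have [] := hp.
apply/cvgrPdist_lt => eps e0; set c := p k (unit_ext i).
have c1 : 0 < c + 1 by rewrite ltr_wpDl ?c0.
have := coord_ext_continuous i f (divr_gt0 e0 c1).
apply: filterS => g; rewrite /= !pZ -/c ltr_pdivlMr// => h.
have h1 := modulusD (coord_ext i g - coord_ext i f) (coord_ext i f).
have h2 := modulusD (- (coord_ext i g - coord_ext i f)) (coord_ext i g).
rewrite subrK in h1; rewrite modulusN opprB subrK in h2.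
rewrite -mulrBl normrM (ger0_norm (c0 _)); apply: le_lt_trans h.
apply: ler_pM; [exact: normr_ge0 | exact: c0 | | by rewrite lerDl].
by rewrite ler_norml; lra.
Qed.

Lemma bounded_of_tail (h : nat -> R) (N : nat) c :
  (forall n, (N <= n)%N -> h n <= c) -> exists C, forall n, h n <= C.
Proof.
elim: N c => [|N IH] c hc; first by exists c => n; apply: hc.
apply: (IH (Num.max c (h N))) => n; rewrite leq_eqVlt => /orP[/eqP <-|/hc nc].
  by rewrite le_max lexx orbT.
by rewrite le_max nc.
Qed.

(** The terms of a convergent expansion are bounded: those of large index are
    differences of two truncations close to f. *)
Lemma coord_proj_bounded k f :
  exists C, forall i, p k (coord_ext i f *: unit_ext i) <= C.
Proof.
have psn : is_seminorm (p k) by have [] := hp.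
have [_ pD _] := psn; have [_ _ pnbhs] := hp.
have [|N hN] := @basis_expansion f [set g | p k (g - f) < 1].
  by rewrite pnbhs; exists (k, 1) => //=.
set u := (fun i : int => coord_ext i f *: unit_ext i) in hN.
have step m n m' n' i :
    (N <= m)%N -> (N <= n)%N -> (N <= m')%N -> (N <= n')%N ->
    band_sum u m' n' = band_sum u m n + u i -> p k (u i) <= 2.
  move=> hm hn hm' hn' E.
  have -> : u i = (band_sum u m' n' - f) - (band_sum u m n - f).
    by rewrite E opprB addrA subrK addrC addKr.
  apply: le_trans (pD _ _) _; rewrite seminormN//.
  by have := hN _ _ hm hn; have := hN _ _ hm' hn'; rewrite /=; lra.
have [C1 h1] : exists C, forall n, p k (u (Posz n)) <= C.
  apply: (@bounded_of_tail _ N 2) => n Nn.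
  apply: (step N n N n.+1) => //; first exact: leqW.
  by rewrite /band_sum big_nat_recr//= addrA.
have [C2 h2] : exists C, forall n, p k (u (Negz n)) <= C.
  apply: (@bounded_of_tail _ N 2) => n Nn.
  apply: (step n N n.+1 N) => //; first exact: leqW.
  by rewrite /band_sum big_nat_recr//= addrAC.
exists (Num.max C1 C2) => -[n|n]; first by rewrite le_max h1.
by rewrite le_max h2 orbT.
Qed.

Context (gauge : X -> R) (hgauge : gauge_of p gauge).
Context (lambda : V -> K) (B : X -> X).
Hypothesis hB : forall f, iota (B f) = backward_shift lambda (iota f).

Definition weight_ext : int -> K := weight_extension 0 lambda.

Lemma sequence_shift_system :
  shift_system gauge B unit_ext coord_ext weight_ext.
Proof.
have [Xm iinj _] := hX.
have BP a x y : B (a *: x + y) = a *: B x + B y.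
  apply: iinj; rewrite funeqE => n.
  rewrite linearP hB [RHS]/GRing.add/= [X in X + _]/GRing.scale/= !hB.
  by rewrite /backward_shift linearP mulrDr mulrCA.
have B0 : B 0 = 0.
  by have := BP (-1) 0 0; rewrite scaler0 addr0 scaleN1r addNr.
have natS (n : nat) : (n + 1)%R = n.+1 := addn1 n.
split.
- exact: coord_linear.
- exact: BP.
- move=> k x; rewrite /coord_ext /weight_ext; clear -hB natS.
  case: v iota lambda k hB => io la [n|n] hBB /=; rewrite ?hBB//=.
  by rewrite /backward_shift natS addn1.
  by case: n => [|n]; rewrite mul0r.
(* Shift of a canonical vector: in the unilateral case, the first one and those
   of negative index are sent to 0. *)
- rewrite /weight_ext /unit_ext; clear -iinj hB he natS B0.
  case: v iota lambda e he hB iinj B0 => io la ee hee hBB io_inj B0 k;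
    apply: io_inj; rewrite funeqE => j.
  - case: k => [[|n]|n].
    + rewrite /= hBB hee scaler0 raddf0 /backward_shift /unit_sequence.
      by rewrite natS /= mulr0.
    + rewrite (_ : n.+1%:Z - 1 = Posz n) /= ?hBB; last by lia.
      rewrite embeddingZ !hee /backward_shift /unit_sequence.
      rewrite natS eqSS.
      by have [->//|_] := eqVneq j n; rewrite ?mulr0.
    + by rewrite /= scale0r B0.
  - rewrite /= hBB embeddingZ !hee /backward_shift /unit_sequence.
    rewrite -subr_eq opprK.
    by have [->//|_] := eqVneq (j + 1) k; rewrite ?mulr0.
- exact: coord_ext_unit.
- move=> k f /coord_ext_diag; apply: contra_eq_neq => ->.
  by rewrite coord_ext0 eq_sym oner_neq0.
- rewrite /weight_ext /unit_ext; clear -he.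
  have en n : e n != 0.
    apply/eqP => en0; have := congr1 (fun u => u n) (he n).
    by rewrite en0 raddf0 /unit_sequence eqxx => /esym/eqP; rewrite oner_eq0.
  clear he; case: v e lambda en => ee la een; last by move=> k _; apply: een.
  by case=> [[|n]|n]; rewrite /= ?eqxx// => _; exact: een.
- move=> eps e0; have [k [eta eta0 h]] := small_gauge hp hgauge e0.
  have [k' [eta' eta'0 h']] := uniformly_bounded_seminorms Xm hp
    (coord_proj_seminorm k) (@coord_proj_continuous k) (coord_proj_bounded k)
    eta0.
  have [eps' eps'0 hg] := gauge_small hp hgauge k' eta'0.
  by exists eps' => // x /hg/h' hx i; apply: h.
- move=> f eps e0; have [k [eta eta0 h]] := small_gauge hp hgauge e0.
  have [_ _ pnbhs] := hp.
  have [|N hN] := @basis_expansion f [set g | p k (g - f) < eta].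
    by rewrite pnbhs; exists (k, eta).
  by exists N => m n Nm Nn; apply: h; apply: hN.
Qed.

End SequenceSpace.

Theorem corollary5p2 (R : realType) (s : scalar_kind) (v : index_kind)
  (X : tvsType (scalars R s))
  (iota : {linear X -> (shift_index v -> (scalars R s)^o)})
  (hX : frechet_sequence_space iota)
  (e : shift_index v -> X)
  (he : forall n, iota (e n) = unit_sequence R s n)
  (hbasis : schauder_basis e)
  (p : nat -> X -> R) (hp : inducing_seminorms p)
  (gauge : X -> R) (hgauge : gauge_of p gauge)
  (lambda : shift_index v -> scalars R s)
  (B : X -> X)
  (hB : forall f, iota (B f) = backward_shift lambda (iota f)) :
  let d := gauge_dist gauge in
  exists S : CR d B -> CR d B,
    [/\ is_restriction B S,
        \val @` CR (restricted_dist d (CR d B)) S = CR d B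
      & chain_recurrent (restricted_dist d (CR d B)) S].
Proof.
move=> d; have [Xm _ _] := hX.
have [S [restr rec]] := CR_restriction (gauge_Fnorm hp hgauge Xm)
  (sequence_shift_system hX he hbasis hp hgauge hB).
exists S; split=> //; rewrite rec; apply/seteqP; split=> [_ [f _ <-]|f ff].
  exact: set_valP.
by exists (SigSub (mem_set ff)).
Qed.
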